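(* Let $p,q\ge 1$ be integers and let $\mu_{p,q}:\mathbb{CP}^2\dashrightarrow\mathbb{CP}^2$ be the birational map given in affine coordinates by $$\mu_{p,q}=\mu^{(2)}_{p,q}\circ\mu^{(1)}_{p,q},\qquad \mu^{(1)}_{p,q}(x,y)=\left(\frac{1+y^q}{x},\,y\right),\qquad \mu^{(2)}_{p,q}(x,y)=\left(x,\,\frac{1+x^p}{y}\right).$$ Let $\lambda_1(\mu_{p,q})$ be its dynamical degree. Then: (i) if $pq\le 4$, then $\lambda_1(\mu_{p,q})=1$; (ii) if $pq>4$, then $$\lambda_1(\mu_{p,q})=\frac{pq-2+\sqrt{(pq-2)^2-4}}{2}>1.$$
   Context: Everything is over $\mathbb{C}$, and $\mathbb{C}^2\subset\mathbb{CP}^2$ via $(x,y)\mapsto[x:y:1]$. A rational map $f:\mathbb{CP}^2\dashrightarrow\mathbb{CP}^2$ is written in homogeneous coordinates as $[f_1:f_2:f_3]$ with $f_1,f_2,f_3$ homogeneous polynomials of the same degree with no common factor of positive degree; this common degree is the algebraic degree $d_{\rm alg}(f)$. The dynamical degree of $f$ is $\lambda_1(f)=\lim_{n\to\infty}\left(d_{\rm alg}(f^n)\right)^{1/n}$, where $f^n$ is the $n$-th iterate (the limit always exists). *)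

(* Defs.v *)
From HB Require Import structures.
From mathcomp Require Import all_boot all_order all_algebra.
From mathcomp Require Import fraction complex.
(* Importing mpoly after the analysis files makes the notations clash. *)
From mathcomp Require Import mpoly.
From mathcomp Require Import boolp classical_sets reals topology normedtype.
From mathcomp Require Import sequences exp.

Set Implicit Arguments.
Unset Strict Implicit.
Unset Printing Implicit Defensive.

Import Order.TTheory GRing.Theory Num.Theory numFieldNormedType.Exports.

Local Open Scope classical_set_scope.
Local Open Scope ring_scope.

Section RationalMaps.
Context (R : realType).

Local Notation C := (R[i]).

(* The field C(x, y) of rational functions on C^2. *)
Definition ratfun : fieldType := {fraction {mpoly C[2]}}.

Definition no_common_factor (F : 3.-tuple {mpoly C[3]}) : Prop :=
  ~ exists k : {mpoly C[3]},
      (1 < msize k)%N /\ forall i, exists h, tnth F i = h * k.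

(* A rational map CP^2 --> CP^2 in reduced homogeneous coordinates
   [f_1 : f_2 : f_3].  The zero triple has common factors of positive degree,
   hence is excluded.  Two triples that differ by a nonzero scalar are the same
   rational map. *)
Record ratmap := RatMap {
  alg_degree : nat;
  ratmap_coords :> 3.-tuple {mpoly C[3]};
  ratmap_homog : forall i, tnth ratmap_coords i \is alg_degree.-homog;
  ratmap_reduced : no_common_factor ratmap_coords }.

HB.instance Definition _ := gen_eqMixin ratmap.
HB.instance Definition _ := gen_choiceMixin ratmap.

Definition id_coords : 3.-tuple {mpoly C[3]} := [tuple 'X_i | i < 3].

Lemma id_coords_homog i : tnth id_coords i \is 1.-homog.
Proof. by rewrite tnth_mktuple dhomogX /= mdeg1. Qed.

Lemma id_coords_reduced : no_common_factor id_coords.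
Proof.
move=> [k [k1 hk]].
pose j : 'I_3 := Ordinal (isT : 1 < 3)%N.
have cst i : exists2 c : C, c != 0 & 'X_i = c *: k.
  have [h] := hk i; rewrite tnth_mktuple => Xi.
  have /(congr1 (fun p : {mpoly C[3]} => msize p)) := Xi.
  have nz : h * k != 0 by rewrite -Xi -msize_poly_eq0 msizeX.
  move: nz; rewrite mulf_eq0 negb_or => /andP[h0 k0].
  rewrite msizeX mdeg1 msizeM // => sz.
  have h1 : msize h == 1%N.
    move: h0 sz k1; rewrite -msize_poly_eq0.
    case: (msize h) => [|[|n]] // _; case: (msize k) => [|[|m]] //.
    by rewrite !addSn !addnS.
  have /msize_poly1P [c c0 hc] := h1.
  by exists c => //; rewrite Xi hc mul_mpolyC.
have [a a0 ea] := cst ord0; have [b b0 eb] := cst j.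
have : b *: 'X_ord0 = a *: 'X_j :> {mpoly C[3]}.
  by rewrite ea eb !scalerA mulrC.
move=> /(congr1 (mcoeff U_(ord0))); rewrite !mcoeffZ !mcoeffX eqxx mulr1.
have -> : (U_(j) == U_(ord0))%MM = false.
  by apply/eqP => /mnmP /(_ ord0); rewrite !mnm1E.
by rewrite mulr0 => b00; rewrite b00 eqxx in b0.
Qed.

Definition ratmap_id : ratmap := RatMap id_coords_homog id_coords_reduced.

(* The rational map [F_1 : F_2 : F_3], after division by the common factor k
   of the coordinates; unique up to a nonzero scalar.  It is the identity, as a
   junk value, when F does not define a rational map (e.g. when F = 0). *)
Definition reduce (F : 3.-tuple {mpoly C[3]}) : ratmap :=
  xget ratmap_id [set f : ratmap |
    exists2 k : {mpoly C[3]}, k != 0 & forall i, tnth F i = k * tnth f i].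

(* The composition g o f; it is only meaningful when the image of f is not
   contained in the indeterminacy locus of g, in particular for f dominant. *)
Definition ratmap_comp (g f : ratmap) : ratmap :=
  reduce [tuple tnth g i \mPo f | i < 3].

Definition ratmap_iter (n : nat) (f : ratmap) : ratmap :=
  iter n (ratmap_comp f) ratmap_id.

(* Restriction of a form to C^2, embedded in CP^2 by (x, y) |-> [x : y : 1]. *)
Definition dehomogenize (P : {mpoly C[3]}) : ratfun :=
  tofrac (P \mPo [tuple 'X_ord0; 'X_ord_max; 1 : {mpoly C[2]}]).

Definition given_in_affine (uv : ratfun * ratfun) (f : ratmap) : Prop :=
  exists f1 f2 f3 : {mpoly C[3]},
    [/\ ratmap_coords f = [tuple f1; f2; f3],
        dehomogenize f3 != 0,
        uv.1 = dehomogenize f1 / dehomogenize f3 &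
        uv.2 = dehomogenize f2 / dehomogenize f3].

(* The rational map given in affine coordinates by (x, y) |-> (u, v); its
   reduced triple is unique up to a nonzero scalar. *)
Definition ratmap_of_affine (uv : ratfun * ratfun) : ratmap :=
  xget ratmap_id [set f : ratmap | given_in_affine uv f].

Definition coord_x : ratfun := tofrac ('X_ord0 : {mpoly C[2]}).
Definition coord_y : ratfun := tofrac ('X_ord_max : {mpoly C[2]}).

Definition mu1 (p q : nat) : ratmap :=
  ratmap_of_affine ((1 + coord_y ^+ q) / coord_x, coord_y).

Definition mu2 (p q : nat) : ratmap :=
  ratmap_of_affine (coord_x, (1 + coord_x ^+ p) / coord_y).

Definition mu (p q : nat) : ratmap := ratmap_comp (mu2 p q) (mu1 p q).

(* (d_alg (f^n))^(1/n); the value at n = 0 is irrelevant. *)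
Definition degree_growth (f : ratmap) (n : nat) : R :=
  (alg_degree (ratmap_iter n f))%:R `^ n%:R^-1.

(* limn is total: it has a default value when the sequence does not converge. *)
Definition dynamical_degree (f : ratmap) : R := limn (degree_growth f).

End RationalMaps.

(* Main.v *)
Require Import Defs.
From HB Require Import structures.
From mathcomp Require Import all_boot all_order all_algebra.
From mathcomp Require Import fraction complex mpoly zify ring lra.
From mathcomp Require Import boolp classical_sets reals topology normedtype.
From mathcomp Require Import sequences exp realfun.
Import Order.TTheory GRing.Theory Num.Theory numFieldNormedType.Exports.
Local Open Scope ring_scope.

Set Implicit Arguments.
Unset Strict Implicit.
Unset Printing Implicit Defensive.

(** The maps [mu1] and [mu2] are the mutations of a cluster algebra of rank 2.
    Write [w 0 = x], [w 1 = y] and [w (k + 2) = (1 + w (k + 1) ^ e) / w k], where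
    the exponent [e] alternates between [q] and [p]; then [mu ^ n] is the map
    [(x, y) |-> (w (2 n), w (2 n + 1))]  ([iter_represents]).  Naively the degrees
    of the [w k] grow too fast: the theorem is about the cancellations in
    [(1 + w (k + 1) ^ e) / w k].

    The cancellations are governed by the Laurent phenomenon: each [w k] is a
    Laurent polynomial in the homogeneous coordinates.  It follows from an identity
    which expresses [w (k + 4)] polynomially in [w k], [w (k + 2)], [w (k + 3)]
    ([laurent_exchange]).  Hence [w k = P / X ^ a] for a form [P] and an integer
    vector [a].  This fraction is kept in lowest terms by positivity: [P] is positive
    at the three points that have one coordinate 0 and the others 1, hence no
    coordinate divides [P].  Comparing the orders along the three coordinate lines
    on both sides of the exchange relation then determines the vectors exactly: they
    satisfy the tropical recurrence [a (k + 2) = max 0 (e * a (k + 1)) - a k]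
    ([form_exchange], [cluster_form]).

    Clearing denominators of [(w (2 n), w (2 n + 1))] by the least monomial [X ^ t]
    yields a reduced triple, and the reduced triple of a rational map is unique up to
    a scalar; hence the degree of [mu ^ n] is the degree of [t]
    ([represents_unique], [alg_degree_iter]).

    What remains is the growth of three integer sequences.  If [p q <= 3] the tropical
    map is periodic on the three initial vectors.  If [p q >= 4] each orbit enters a
    cone on which the recurrence is linear, with
    [U (n + 2) = (p q - 2) U (n + 1) - U n]; so it is [O(n l ^ n)] for every root
    [l >= 1] of [l ^ 2 - (p q - 2) l + 1], and the orbit of the first coordinate is
    bounded below by [l ^ n].  An [n]-th root removes the linear factor
    ([root_growth]). *)

Local Notation i0 := (ord0 : 'I_3).
Local Notation i1 := (Ordinal (isT : 1 < 3)%N : 'I_3).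
Local Notation i2 := (ord_max : 'I_3).

(** * Divisibility by monomials *)

Section MonomialDivision.
Context (n : nat) (F : idomainType).
Implicit Types (p : {mpoly F[n]}) (m : 'X_{1..n}).

Definition kill_var (i : 'I_n) : n.-tuple {mpoly F[n]} :=
  [tuple (if j == i then 0 else 'X_j) | j < n].

(** Setting ['X_i] to 0 is a ring morphism into a domain; that its kernel consists
    of the multiples of ['X_i] makes ['X_i] prime. *)
Lemma kill_var_divides i p : exists r, p = (p \mPo kill_var i) + 'X_i * r.
Proof.
elim/mpolyind: p => [|c m p _ _ [r hr]]; first by exists 0; rewrite raddf0 mulr0 addr0.
have [s hs] : exists s, 'X_[m] = ('X_[m] \mPo kill_var i) + 'X_i * s.
  pose Q : {mpoly F[n]} := \prod_(j < n | j != i) 'X_j ^+ m j.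
  have -> : 'X_[m] \mPo kill_var i = 0 ^+ m i * Q.
    rewrite comp_mpolyX (bigD1 i) //= tnth_mktuple eqxx; congr (_ * _).
    by apply: eq_bigr => j /negbTE ji; rewrite tnth_mktuple ji.
  have -> : 'X_[m] = 'X_i ^+ m i * Q by rewrite mpolyXE_id (bigD1 i).
  case: (m i) => [|k]; first by exists 0; rewrite mulr0 addr0.
  by exists ('X_i ^+ k * Q); rewrite !exprS !mul0r add0r mulrA.
exists (c *: s + r); rewrite comp_mpolyD comp_mpolyZ {1}hr {1}hs.
by rewrite scalerDr mulrDr scalerAr addrACA.
Qed.

(** A point of the hyperplane ['X_i = 0]: a polynomial that does not vanish there is
    not divisible by ['X_i].  For the numerators of cluster variables this is checked
    by positivity, whence the nonzero coordinates 1. *)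
Definition corner_point (i j : 'I_n) : F := (j != i)%:R.

Lemma meval_kill_var i p : (p \mPo kill_var i).@[corner_point i] = p.@[corner_point i].
Proof.
rewrite comp_mpoly_meval; apply: meval_eq => j; rewrite tnth_mktuple /corner_point.
by have [_|ji] := eqVneq j i; rewrite ?meval0 // mevalXU ji.
Qed.

Lemma var_dvd_left i (A B C : {mpoly F[n]}) :
  'X_i * B = A * C -> C.@[corner_point i] != 0 -> exists A', A = 'X_i * A'.
Proof.
move=> e C0; have [r hr] := kill_var_divides i A.
have /eqP : (A \mPo kill_var i) * (C \mPo kill_var i) = 0.
  rewrite -rmorphM /= -e rmorphM /= -['X_i \mPo _]/(mmap _ _ _) mmapX mmap1U.
  by rewrite tnth_mktuple eqxx mul0r.
rewrite mulf_eq0 => /orP[/eqP A0|/eqP Ck0]; first by exists r; rewrite {1}hr A0 add0r.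
by move: C0; rewrite -meval_kill_var Ck0 meval0 eqxx.
Qed.

Lemma mpolyX_neq0 m : 'X_[m] != 0 :> {mpoly F[n]}.
Proof. by rewrite -msize_poly_eq0 msizeX. Qed.

(** The family [Phi] has no coordinate as a common factor, so each coordinate can be
    moved from ['X_[m]] into [A], with a member of [Phi] that depends on the
    coordinate.  Used with one member for exact division, and with the three
    coordinates of a map to compare triples. *)
Lemma monomial_dvd (J : Type) (Phi G : J -> {mpoly F[n]}) m A :
    (forall i, exists j, (Phi j).@[corner_point i] != 0) ->
    (forall j, 'X_[m] * G j = A * Phi j) ->
  exists s, A = 'X_[m] * s.
Proof.
move=> prim; have [k] := ubnP (mdeg m); elim: k m A => // k IH m A mk e.
have [/eqP m0|mN0] := eqVneq (mdeg m) 0%N.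
  by move: m0; rewrite mdeg_eq0 => /eqP ->; exists A; rewrite mpolyX0 mul1r.
have [i mi] : exists i, (0 < m i)%N.
  apply/existsP; apply: contraNT mN0; rewrite negb_exists => /forallP h.
  by rewrite mdegE big1 // => i _; apply/eqP; rewrite -leqn0 leqNgt h.
have mE : m = (U_(i) + (m - U_(i)))%MM.
  apply/mnmP => j; rewrite mnmDE mnmBE mnm1E; case: eqP => [<-|_]; last by rewrite subn0.
  by rewrite subnKC.
have [j Pj] := prim i.
have [A' hA'] : exists A', A = 'X_i * A'.
  by apply: (@var_dvd_left i A ('X_[m - U_(i)] * G j) (Phi j)) => //; rewrite mulrA -mpolyXD -mE.
have [s hs] : exists s, A' = 'X_[m - U_(i)] * s.
  apply: IH => [|l].
    by move: mk; rewrite {1}mE mdegD mdeg1 add1n ltnS.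
  apply: (mulfI (mpolyX_neq0 U_(i))).
  by rewrite !mulrA -hA' -mpolyXD -mE.
by exists s; rewrite hA' hs mulrA -mpolyXD -mE.
Qed.

Lemma dhomog_divX d m (A : {mpoly F[n]}) : 'X_[m] * A \is d.-homog -> A \is (d - mdeg m).-homog.
Proof.
move=> /dhomogP h; apply/dhomogP => k kA.
have : (m + k)%MM \in msupp ('X_[m] * A).
  by rewrite mcoeff_msupp mulrC mcoeffMX -mcoeff_msupp.
by move/h => /= <-; rewrite mdegD addKn.
Qed.

End MonomialDivision.

(** * Laurent fractions in lowest terms *)

Section LaurentFractions.
Context (F : numFieldType).
Local Notation n := 3.
Local Notation poly := {mpoly F[n]}.
Local Notation K := {fraction {mpoly F[n]}}.
Implicit Types (w : K) (m k l : 'X_{1..n}) (P Q : poly) (a b : 'I_n -> int).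
Local Notation tof := (@tofrac {mpoly F[n]}).
Local Notation corner := (@corner_point n F).

Lemma tofrac_inj : injective tof.
Proof. by move=> P Q /eqP; rewrite tofrac_eq => /eqP. Qed.

Lemma tofX_neq0 m : tof 'X_[m] != 0.
Proof. by rewrite tofrac_eq0 mpolyX_neq0. Qed.

Lemma tofXD m k : tof 'X_[m + k] = tof 'X_[m] * tof 'X_[k].
Proof. by rewrite mpolyXD tofracM. Qed.

Lemma meval_corner_mpolyX i m : ('X_[m] : poly).@[corner i] = (m i == 0%N)%:R.
Proof.
rewrite mevalX (bigD1 i) //= big1 => [|j ji]; last by rewrite /corner_point ji expr1n.
by rewrite mulr1 /corner_point eqxx expr0n.
Qed.

(** Laurent polynomials that are homogeneous of degree 0: the ring in which the
    Laurent phenomenon takes place. *)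
Definition laurent w :=
  exists m P, P \is (mdeg m).-homog /\ tof P = w * tof 'X_[m].

Lemma laurentM w1 w2 : laurent w1 -> laurent w2 -> laurent (w1 * w2).
Proof.
move=> [m1 [P1 [h1 e1]]] [m2 [P2 [h2 e2]]]; exists (m1 + m2)%MM, (P1 * P2).
by rewrite mdegD dhomogM // tofXD tofracM e1 e2 mulrACA.
Qed.

Lemma laurentD w1 w2 : laurent w1 -> laurent w2 -> laurent (w1 + w2).
Proof.
move=> [m1 [P1 [h1 e1]]] [m2 [P2 [h2 e2]]].
exists (m1 + m2)%MM, (P1 * 'X_[m2] + P2 * 'X_[m1]); split.
  rewrite mdegD; apply: dhomogD; first by rewrite dhomogM // dhomogX /=.
  by rewrite addnC dhomogM // dhomogX /=.
by rewrite tofXD tofracD !tofracM e1 e2 mulrDl !mulrA [X in _ + X]mulrAC.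
Qed.

Lemma laurentN w : laurent w -> laurent (- w).
Proof.
move=> [m [P [h e]]]; exists m, (- P).
by rewrite tofracN e mulNr; split=> //; rewrite dhomogN.
Qed.

Lemma laurent1 : laurent 1.
Proof. by exists 0%MM, 1; rewrite mdeg0 dhomog1 mpolyX0 tofrac1 mulr1. Qed.

Lemma laurentX w e : laurent w -> laurent (w ^+ e).
Proof.
by move=> h; elim: e => [|e IH]; [exact: laurent1 | rewrite exprS; exact: laurentM].
Qed.

Lemma laurent_sum (e : nat) (f : 'I_e -> K) :
  (forall i, laurent (f i)) -> laurent (\sum_(i < e) f i).
Proof.
move=> h; apply: big_ind => //; last exact: laurentD.
by rewrite -(subrr 1); apply: laurentD; [|apply: laurentN]; exact: laurent1.
Qed.

(** The Laurent phenomenon in rank 2.  As [w3 ^ b * (1 + w1 ^ b)] is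
    [w3 ^ b + (1 + w2 ^ c) ^ b], one has
    [w4 = w0 w3 ^ b - ((1 + w2 ^ c) ^ b - 1) / w2], and the last quotient is a
    polynomial in [w2].  The division by [w2] has disappeared. *)
Lemma laurent_exchange (b c : nat) w0 w1 w2 w3 w4 : (0 < c)%N ->
    w1 != 0 -> w2 != 0 ->
    w0 * w2 = 1 + w1 ^+ b -> w1 * w3 = 1 + w2 ^+ c -> w2 * w4 = 1 + w3 ^+ b ->
  laurent w0 -> laurent w2 -> laurent w3 -> laurent w4.
Proof.
move=> c0 w1N0 w2N0 e02 e13 e24 L0 L2 L3.
have -> : w4 = w0 * w3 ^+ b - w2 ^+ c.-1 * \sum_(i < b) (1 + w2 ^+ c) ^+ i.
  apply: (mulfI w2N0); rewrite mulrBr e24 [w2 * (w0 * _)]mulrA [w2 * w0]mulrC e02 mulrDl.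
  rewrite mul1r -exprMn e13 mulrA -exprS prednK //.
  have -> : w2 ^+ c * (\sum_(i < b) (1 + w2 ^+ c) ^+ i) = (1 + w2 ^+ c) ^+ b - 1.
    by rewrite subrX1 [1 + _ - 1]addrC addKr.
  ring.
apply: laurentD; first by apply: laurentM => //; exact: laurentX.
apply/laurentN/laurentM; first exact: laurentX.
by apply: laurent_sum => i; apply/laurentX/laurentD; [exact: laurent1 | exact: laurentX].
Qed.

(** [w = P / X ^ a] in lowest terms.  To stay within polynomials, the integer vector
    [a] is written as a difference of two multi-indices in every possible way;
    positivity at the corners says that no coordinate divides [P]. *)
Definition reduced_form w a P := 
  [/\ exists2 d : nat, P \is d.-homog & d%:Z = \sum_i a i,
      forall i, 0 < P.@[corner i] &
      forall m k, (forall i, a i = (m i)%:Z - (k i)%:Z) ->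
        tof (P * 'X_[k]) = w * tof 'X_[m]].

Definition has_form w a := exists P, reduced_form w a P.

Definition pos_part a := [multinom absz (Num.max 0 (a i))%R | i < n].
Definition neg_part a := [multinom absz (Num.max 0 (- a i))%R | i < n].

Lemma pos_neg_part a i : a i = (pos_part a i)%:Z - (neg_part a i)%:Z.
Proof. rewrite !mnmE; lia. Qed.

(** One way of writing [a] as a difference is enough, by cancellation. *)
Lemma reduced_formI w a P d m k : P \is d.-homog -> d%:Z = \sum_i a i ->
   (forall i, 0 < P.@[corner i]) -> (forall i, a i = (m i)%:Z - (k i)%:Z) ->
   tof (P * 'X_[k]) = w * tof 'X_[m] -> reduced_form w a P.
Proof.
move=> hP hd Pc amk e; split=> //; first by exists d.
move=> m' k' amk'; apply: (mulIf (tofX_neq0 k)).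
have mk : (m + k')%MM = (m' + k)%MM.
  by apply/mnmP => i; rewrite !mnmDE; have := amk i; rewrite amk'; lia.
by rewrite -mulrA -tofXD -mk tofXD mulrA -e !tofracM mulrAC.
Qed.

Lemma form_neq0 w a : has_form w a -> w != 0.
Proof.
case=> P [_ Pc e]; apply/eqP => w0; move: (e _ _ (pos_neg_part a)); rewrite w0 mul0r => /eqP.
rewrite tofrac_eq0 mulf_eq0 (negbTE (mpolyX_neq0 _ _)) orbF => /eqP P0.
by have := Pc ord0; rewrite P0 meval0 ltxx.
Qed.

Lemma form_laurent w a : has_form w a -> laurent w.
Proof.
case=> P [[d hd da] _ e]; exists (pos_part a), (P * 'X_[neg_part a]); split; last first.
  exact/e/pos_neg_part.
have -> : mdeg (pos_part a) = (d + mdeg (neg_part a))%N.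
  apply/eqP; rewrite -eqz_nat PoszD da !mdegE !(big_morph Posz PoszD (erefl _)) -big_split.
  by apply/eqP/eq_bigr => i _ /=; have := pos_neg_part a i; lia.
by rewrite dhomogM // dhomogX /=.
Qed.

(** The exponents of a new cluster variable are forced.  With [S] the numerator of
    [1 + w1 ^ e] over its obvious denominator, [S] is a sum of two terms at least one
    of which survives at each corner, hence [S] is positive there.  Since
    [P * P2 = S], so is [P2], and no coordinate can cancel further.  That [P2] is a
    polynomial uses that [w2] is Laurent: its denominator is a monomial, prime to
    [P]. *)
Lemma form_exchange (e : nat) w w1 w2 a b :
    has_form w a -> has_form w1 b -> w2 * w = 1 + w1 ^+ e -> laurent w2 ->
  has_form w2 (fun i => Num.max 0 (e%:Z * b i) - a i).
Proof.
move=> fw [P1 [_ Pc1 /(_ _ _ (pos_neg_part b)) e1]] ex [l [W [hW eW]]].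
have w0 := form_neq0 fw; case: fw => P [[d hd da] Pc /(_ _ _ (pos_neg_part a)) e0].
set m := pos_part a in e0; set k := neg_part a in e0.
pose M := (pos_part b *+ e)%MM; pose N := (neg_part b *+ e)%MM.
pose S := 'X_[M] + P1 ^+ e * 'X_[N].
have SE : tof S = (1 + w1 ^+ e) * tof 'X_[M].
  rewrite mulrDl mul1r tofracD; congr (_ + _).
  by rewrite /M /N -!mpolyXn -exprMn !tofracXn e1 exprMn.
have PW : 'X_[m + l] * S = (W * 'X_[M + k]) * P.
  apply: tofrac_inj; rewrite !mpolyXD !tofracM SE eW -ex.
  transitivity (w2 * tof 'X_[l] * tof 'X_[M] * (w * tof 'X_[m])); first by ring.
  by rewrite -e0 tofracM; ring.
have [P2 hP2] : exists P2, W * 'X_[M + k] = 'X_[m + l] * P2.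
  apply: (@monomial_dvd _ _ unit (fun _ => P) (fun _ => S)) => // i.
  by exists tt; rewrite gt_eqF.
have PP2 : S = P2 * P.
  by apply: (mulfI (mpolyX_neq0 F (m + l))); rewrite PW hP2 mulrA.
have Sc i : 0 < S.@[corner i].
  rewrite /S mevalD mevalM !meval_corner_mpolyX rmorphXn /= !mulmnE.
  have Pe : 0 < P1.@[corner i] ^+ e by rewrite exprn_gt0.
  have : (pos_part b i * e == 0)%N || (neg_part b i * e == 0)%N by rewrite !mnmE; nia.
  by case: eqP => _; case: eqP => _ //= _; rewrite ?mulr1 ?mulr0 ?addr0 ?add0r // addr_gt0.
have P2c i : 0 < P2.@[corner i].
  by have := Sc i; rewrite PP2 mevalM pmulr_lgt0.
have hom : W * 'X_[M + k] \is (mdeg l + mdeg (M + k)).-homog.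
  by rewrite dhomogM // dhomogX /=.
have hP2d : P2 \is (mdeg l + mdeg (M + k) - mdeg (m + l)).-homog.
  by apply: dhomog_divX; rewrite -hP2.
set d2 := (_ - _)%N in hP2d.
have P2N0 : P2 != 0.
  by apply: contraTneq (P2c ord0) => ->; rewrite meval0 ltxx.
have d2E : (mdeg (M + k) = mdeg m + d2)%N.
  have hom' : W * 'X_[M + k] \is (mdeg (m + l) + d2).-homog.
    by rewrite hP2 dhomogM // dhomogX /=.
  have nz : W * 'X_[M + k] != 0 by rewrite hP2 mulf_neq0 // mpolyX_neq0.
  have := dhomog_uniq nz hom hom'; rewrite !mdegD; lia.
have amk i : Num.max 0 (e%:Z * b i) - a i = ((M + k)%MM i)%:Z - (m i)%:Z.
  have Mi : (M i)%:Z = Num.max 0 (e%:Z * b i).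
    rewrite mulmnE mnmE; case: (lerP 0 (b i)) => bi; last by rewrite max_l; nia.
    by rewrite max_r; nia.
  by rewrite mnmDE PoszD Mi (pos_neg_part a i) -/m -/k; ring.
exists P2; apply: (@reduced_formI _ _ _ d2 (M + k) m) => //.
  have : (mdeg (M + k))%:Z - (mdeg m)%:Z = d2%:Z by rewrite d2E; lia.
  move=> <-; rewrite !mdegE !(big_morph Posz PoszD (erefl _)) -sumrB.
  by apply: eq_bigr => i _; rewrite amk.
apply: (mulIf (tofX_neq0 l)); rewrite -tofracM -mulrA -mpolyXD mulrC -hP2.
by rewrite tofracM eW mulrAC.
Qed.

End LaurentFractions.

(** * Reduced triples of rational maps *)

Section Representation.
Context (R : realType).
Local Notation C := (R[i]).
Local Notation poly := {mpoly C[3]}.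
Local Notation K := {fraction {mpoly C[3]}}.
Local Notation tof := (@tofrac {mpoly C[3]}).
Implicit Types (t : 'X_{1..3}) (a b : 'I_3 -> int) (P Q s : poly) (u v w : K) (f : 3.-tuple poly).

Local Notation corner := (@corner_point 3 C).

Lemma ord3_cases (A : 'I_3 -> Prop) : A i0 -> A i1 -> A i2 -> forall i, A i.
Proof.
by move=> h0 h1 h2 [[|[|[|//]]] h];
  [move: h0 | move: h1 | move: h2]; congr A; apply: val_inj.
Qed.

(** The triple [f] is, in the affine coordinates [x = X_0 / X_2] and
    [y = X_1 / X_2], the map to [(u, v)]. *)
Definition represents f u v :=
  [/\ tnth f i2 != 0, tof (tnth f i0) = u * tof (tnth f i2) &
      tof (tnth f i1) = v * tof (tnth f i2)].

Definition common_denom a b : 'X_{1..3} :=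
  [multinom absz (Num.max 0 (Num.max (a i) (b i)))%R | i < 3].

Lemma common_denom_gea a b i : a i <= (common_denom a b i)%:Z.
Proof. rewrite mnmE; lia. Qed.

Lemma common_denom_geb a b i : b i <= (common_denom a b i)%:Z.
Proof. rewrite mnmE; lia. Qed.

Definition complement_exp (t : 'X_{1..3}) a := [multinom absz ((t i)%:Z - a i)%R | i < 3].

Lemma complement_expE t a i : a i <= (t i)%:Z -> a i = (t i)%:Z - (complement_exp t a i)%:Z.
Proof. rewrite mnmE; lia. Qed.

Lemma complement_exp_deg t a (d : nat) : d%:Z = \sum_i a i -> (forall i, a i <= (t i)%:Z) ->
  (d + mdeg (complement_exp t a) = mdeg t)%N.
Proof.
move=> da at_; apply/eqP; rewrite -eqz_nat PoszD da !mdegE.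
rewrite !(big_morph Posz PoszD (erefl _)) -big_split; apply/eqP/eq_bigr => i _ /=.
by have := complement_expE (at_ i); lia.
Qed.

Definition reduced_triple a b P Q : 3.-tuple poly :=
  let t := common_denom a b in
  [tuple P * 'X_[complement_exp t a]; Q * 'X_[complement_exp t b]; 'X_[t]].

Section ReducedTriple.
Context u v a b P Q (fP : reduced_form u a P) (fQ : reduced_form v b Q).
Let t := common_denom a b.
Let T := reduced_triple a b P Q.

Lemma reduced_triple_represents : represents T u v.
Proof.
case: fP fQ => [_ _ eP] [_ _ eQ]; split=> /=; first exact: mpolyX_neq0.
  by apply: eP => i; apply/complement_expE/common_denom_gea.
by apply: eQ => i; apply/complement_expE/common_denom_geb.
Qed.

Lemma reduced_triple_homog i : tnth T i \is (mdeg t).-homog.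
Proof.
case: fP fQ => [[d hd da] _ _] [[d' hd' db] _ _]; elim/ord3_cases: i.
- rewrite -(complement_exp_deg da (common_denom_gea a b)) /=.
  by rewrite dhomogM // dhomogX /=.
- rewrite -(complement_exp_deg db (common_denom_geb a b)) /=.
  by rewrite dhomogM // dhomogX /=.
- by rewrite dhomogX /=.
Qed.

(** At each coordinate the maximum [t i] is attained by [0], [a i] or [b i], and the
    corresponding entry of the triple is not divisible by ['X_i]. *)
Lemma reduced_triple_corner i : exists j, (tnth T j).@[corner i] != 0.
Proof.
case: fP fQ => [_ Pc _] [_ Qc _].
have [t0|tN0] := eqVneq (t i) 0%N.
  by exists i2; rewrite /= meval_corner_mpolyX t0 oner_eq0.
have : complement_exp t a i = 0%N \/ complement_exp t b i = 0%N.
  by move: tN0; rewrite !mnmE; lia.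
case=> e; [exists i0 | exists i1];
  by rewrite /= mevalM meval_corner_mpolyX -/t e eqxx mulr1 gt_eqF.
Qed.

(** Any triple for [(u, v)] is proportional to the reduced one over the fraction
    field; as the last entry of the reduced one is a monomial, the factor is a
    polynomial. *)
Lemma represents_multiple f : represents f u v ->
  exists2 s, s != 0 & forall i, tnth f i = s * tnth T i.
Proof.
move=> [f2N0 f0 f1]; have [_ T0 T1] := reduced_triple_represents.
have prop j : 'X_[t] * tnth f j = tnth f i2 * tnth T j.
  apply: tofrac_inj; rewrite !tofracM; elim/ord3_cases: j.
  - by rewrite f0 T0 /=; ring.
  - by rewrite f1 T1 /=; ring.
  - by rewrite /= mulrC.
have [s hs] := monomial_dvd reduced_triple_corner prop.
exists s; first by apply: contraNneq f2N0 => s0; rewrite hs s0 mulr0.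
by move=> i; apply: (mulfI (mpolyX_neq0 C t)); rewrite prop hs mulrA.
Qed.

Lemma reduced_triple_reduced : no_common_factor T.
Proof.
case=> k [k1 hk].
have kc i : k.@[corner i] != 0.
  have [j] := reduced_triple_corner i; have [h ->] := hk j.
  by rewrite mevalM mulf_eq0 negb_or => /andP[].
have [h Xh] : exists h, 'X_[t] = h * k := hk i2.
have [s hs] : exists s, h = 'X_[t] * s.
  apply: (@monomial_dvd _ _ unit (fun=> k) (fun=> 1)) => [i|_]; first by exists tt.
  by rewrite mulr1.
have sk : 1 = s * k by apply: (mulfI (mpolyX_neq0 C t)); rewrite mulr1 mulrA -hs.
have : s * k != 0 by rewrite -sk oner_neq0.
rewrite mulf_eq0 negb_or => /andP[s0 k0].
have /(congr1 (fun x : poly => msize x)) := sk; rewrite /= msize1 msizeM // => sz.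
move: s0 k1 sz; rewrite -msize_poly_eq0; move: (msize s) (msize k) => x y; lia.
Qed.

Definition reduced_ratmap : ratmap R :=
  RatMap reduced_triple_homog reduced_triple_reduced.

(** The factor between two reduced triples is a constant, since it divides all the
    entries of [h].  That the last entry of [h] is a monomial ensures later that
    composition with [h] is legitimate. *)
Lemma represents_unique (h : ratmap R) : represents h u v ->
  alg_degree h = mdeg t /\ exists2 c : C, c != 0 & tnth h i2 = c *: 'X_[t].
Proof.
move=> rh; have [s s0 hs] := represents_multiple rh.
have : (msize s <= 1)%N.
  rewrite leqNgt; apply/negP => s1; apply: (@ratmap_reduced _ h).
  by exists s; split=> // i; exists (tnth T i); rewrite hs mulrC.
move=> s1; have /msize_poly1P[c c0 sE] : msize s == 1%N.
  by move: s0 s1; rewrite -msize_poly_eq0; lia.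
have h2 : tnth h i2 = c *: 'X_[t] by rewrite hs sE mul_mpolyC.
split; last by exists c.
have := ratmap_homog h i2; rewrite h2 => hom.
apply: (@dhomog_uniq _ _ mdeg (c *: 'X_[t])) hom _.
  by rewrite -mul_mpolyC mulf_neq0 ?mpolyX_neq0 // mpolyC_eq0.
by apply: dhomogZ; rewrite dhomogX /=.
Qed.

End ReducedTriple.

(** Removal of the common factor does not change the map; the reduced triple shows
    that a common factor can be removed, so that the default value is not taken. *)
Lemma reduce_represents f u v a b : has_form u a -> has_form v b ->
  represents f u v -> represents (reduce f) u v.
Proof.
move=> [P fP] [Q fQ] rf; rewrite /reduce.
set S := (X in xget _ X).
have Sr : S (reduced_ratmap fP fQ).
  by have [s s0 hs] := represents_multiple fP fQ rf; exists s.
case: xgetP => [g -> [k k0 hk]|/(_ _ Sr)//].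
have [f2 f0 f1] := rf; have k0' : tof k != 0 by rewrite tofrac_eq0.
split; first by apply: contraNneq f2 => g0; rewrite hk g0 mulr0.
  by apply: (mulfI k0'); rewrite -tofracM -hk f0 hk tofracM; ring.
by apply: (mulfI k0'); rewrite -tofracM -hk f1 hk tofracM; ring.
Qed.

Lemma represents_coord_neq0 f u v i : u != 0 -> v != 0 -> represents f u v -> tnth f i != 0.
Proof.
move=> u0 v0 [f2 f0 f1]; have f2' : tof (tnth f i2) != 0 by rewrite tofrac_eq0; exact: f2.
elim/ord3_cases: i; rewrite -tofrac_eq0; [rewrite f0 | rewrite f1 | exact: f2'].
  exact: mulf_neq0 u0 f2'.
exact: mulf_neq0 v0 f2'.
Qed.

End Representation.

(** * The cluster variables and their denominators *)

Section Rec2.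
Context (T : Type) (f : nat -> T -> T -> T) (x y : T).

Fixpoint rec2_pair k : T * T :=
  if k is k'.+1 then let s := rec2_pair k' in (s.2, f k s.1 s.2) else (x, y).

Definition rec2 k := (rec2_pair k).1.

Lemma rec2S k : rec2 k.+2 = f k.+1 (rec2 k) (rec2 k.+1).
Proof. by []. Qed.
End Rec2.

Definition exch_exp (p q k : nat) := if odd k then q else p.

Section ClusterVariables.
Context (F : numFieldType) (p q : nat) (hp : (0 < p)%N) (hq : (0 < q)%N).
Local Notation K := {fraction {mpoly F[3]}}.
Local Notation tof := (@tofrac {mpoly F[3]}).

Definition coord (i : 'I_3) : K := tof 'X_i / tof 'X_i2.

Definition cluster : nat -> K :=
  rec2 (fun k a b => (1 + b ^+ exch_exp p q k) / a) (coord i0) (coord i1).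

(** Exponents of [X_j / X_2]; recall that [a i] is the order of the pole along
    ['X_i = 0]. *)
Definition coord_vec (j i : 'I_3) : int := (i == i2)%:Z - (i == j)%:Z.

(** The pole order of the cluster variables along ['X_i = 0]. *)
Definition trop (i : 'I_3) : nat -> int :=
  rec2 (fun k a b => Num.max 0 ((exch_exp p q k)%:Z * b) - a)
    (coord_vec i0 i) (coord_vec i1 i).

Lemma coord_form j : has_form (coord j) (coord_vec j).
Proof.
exists 1; apply: (@reduced_formI _ _ _ _ 0 U_(i2) U_(j)) => [||i|i|].
- exact: dhomog1.
- have sum1 l : \sum_i (i == l :> 'I_3)%:Z = 1.
    by rewrite (bigD1 l) // big1 ?eqxx ?addr0 // => i /negbTE ->.
  by rewrite sumrB !sum1.
- by rewrite meval1.
- by rewrite !mnm1E ![_ == i]eq_sym.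
- by rewrite mul1r /coord divfK // tofX_neq0.
Qed.

Lemma coordV_laurent j : laurent (coord j)^-1.
Proof.
exists U_(j)%MM, 'X_i2; rewrite dhomogX /= !mdeg1; split=> //.
by rewrite /coord invf_div divfK // tofX_neq0.
Qed.

Lemma clusterS k : cluster k != 0 ->
  cluster k.+2 * cluster k = 1 + cluster k.+1 ^+ exch_exp p q k.+1.
Proof. by move=> wk; rewrite {1}/cluster rec2S divfK. Qed.

Lemma exch_exp_gt0 k : (0 < exch_exp p q k)%N.
Proof. by rewrite /exch_exp; case: odd. Qed.

(** The Laurent phenomenon and the exactness of the exponents are proved together:
    the identity of [laurent_exchange] needs the previous variables to be nonzero,
    which their reduced forms provide. *)
Theorem cluster_form k : has_form (cluster k) (trop^~ k).
Proof.
elim/ltn_ind: k => -[|[|k]] IH; [exact: coord_form | exact: coord_form |].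
have f0 := IH k (leqW (leqnn _)); have f1 := IH k.+1 (leqnn _).
have w0 := form_neq0 f0; have w1 := form_neq0 f1.
apply: (form_exchange f0 f1 (clusterS w0)).
case: k IH f0 f1 w0 w1 => [|[|k]] IH f0 f1 w0 w1.
- apply: laurentM; last exact: coordV_laurent.
  by apply/laurentD/laurentX/form_laurent/f1; exact: laurent1.
- apply: laurentM; last exact: coordV_laurent.
  by apply/laurentD/laurentX/form_laurent/f1; exact: laurent1.
have g0 : has_form (cluster k) (trop^~ k) by apply: IH; rewrite !ltnS; lia.
have g1 : has_form (cluster k.+1) (trop^~ k.+1) by apply: IH; rewrite !ltnS; lia.
have v0 := form_neq0 g0; have v1 := form_neq0 g1.
apply: (@laurent_exchange _ (exch_exp p q k.+1) (exch_exp p q k.+2) (cluster k)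
  (cluster k.+1) (cluster k.+2) (cluster k.+3) (cluster k.+4) (exch_exp_gt0 _) v1 w0).
- by rewrite mulrC; exact: clusterS v0.
- by rewrite mulrC; exact: clusterS v1.
- have := clusterS w0; rewrite /exch_exp /= negbK mulrC => ->.
  by [].
- exact: form_laurent g0.
- exact: form_laurent f0.
- exact: form_laurent f1.
Qed.

Lemma cluster_neq0 k : cluster k != 0.
Proof. exact: form_neq0 (cluster_form k). Qed.

End ClusterVariables.

(** * Passage to the affine chart *)

Lemma cross_mul (L : fieldType) (z A B n d : L) : z != 0 -> d != 0 ->
  z * A = n / d * (z * B) <-> n * B = A * d.
Proof.
move=> z0 d0; split=> e.
  by apply: (mulfI z0); rewrite [RHS]mulrA e; field.
have -> : A = n * B / d by rewrite e mulfK.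
by field.
Qed.

Lemma tofrac_div_eq (A : idomainType) (a b c d : A) : b != 0 -> d != 0 ->
  tofrac a / tofrac b = tofrac c / tofrac d <-> a * d = c * b.
Proof.
move=> b0 d0; split=> [/eqP|e].
  by rewrite eqr_div ?tofrac_eq0 // -!tofracM tofrac_eq => /eqP.
by apply/eqP; rewrite eqr_div ?tofrac_eq0 // -!tofracM e.
Qed.

Section Affine.
Context (R : realType).
Local Notation C := (R[i]).
Local Notation poly := {mpoly C[3]}.
Local Notation K := {fraction {mpoly C[3]}}.
Local Notation tof := (@tofrac {mpoly C[3]}).
Local Notation tof2 := (@tofrac {mpoly C[2]}).
Local Notation cx := (coord C i0).
Local Notation cy := (coord C i1).

Definition affine_chart : 3.-tuple {mpoly C[2]} := [tuple 'X_ord0; 'X_ord_max; 1].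

(** Rehomogenization [A(x, y) |-> A(X_0 / X_2, X_1 / X_2)]. *)
Definition affine_eval : {mpoly C[2]} -> K :=
  mmap (tof \o @mpolyC 3 C) (fun i => if i == ord0 then cx else cy).

HB.instance Definition _ := GRing.RMorphism.on affine_eval.

Lemma affine_evalX0 : affine_eval 'X_ord0 = cx.
Proof. by rewrite /affine_eval mmapX mmap1U. Qed.

Lemma affine_evalX1 : affine_eval 'X_ord_max = cy.
Proof. by rewrite /affine_eval mmapX mmap1U. Qed.

Lemma affine_evalC c : affine_eval c%:MP = tof c%:MP.
Proof. by rewrite /affine_eval mmapC. Qed.

Lemma coordK i : tof 'X_i = coord C i * tof 'X_i2.
Proof. by rewrite divfK // tofX_neq0. Qed.

Lemma affine_eval_monomial m :
  tof 'X_[m] = tof 'X_i2 ^+ mdeg m * affine_eval ('X_[m] \mPo affine_chart).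
Proof.
rewrite comp_mpolyX mpolyXE_id !rmorph_prod mdegE /= !big_ord_recl !big_ord0.
rewrite !rmorphXn /= !(tnth_nth 0) /= affine_evalX0 affine_evalX1 rmorph1 expr1n.
have -> : lift ord0 (ord0 : 'I_2) = i1 by apply: val_inj.
have -> : lift ord0 (lift ord0 (ord0 : 'I_1)) = i2 by apply: val_inj.
by rewrite (coordK i0) (coordK i1) !exprMn !exprD expr0; ring.
Qed.

Lemma affine_eval_homog d (P : poly) : P \is d.-homog ->
  tof P = tof 'X_i2 ^+ d * affine_eval (P \mPo affine_chart).
Proof.
move=> /dhomogP h; rewrite {1}(mpolyE P) comp_mpolyEX !raddf_sum mulr_sumr /=.
apply: eq_big_seq => m /h /= <-; rewrite -!mul_mpolyC !rmorphM /= affine_evalC.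
by rewrite (affine_eval_monomial m) mulrCA.
Qed.

Lemma affine_eval_numerator (A : {mpoly C[2]}) : exists k (P : poly),
  affine_eval A * tof 'X_i2 ^+ k = tof P /\ P \mPo affine_chart = A.
Proof.
elim/mpolyind: A => [|c m A _ _ [k [P [eP hP]]]].
  by exists 0%N, 0; rewrite !raddf0 mul0r.
pose M : poly := 'X_i0 ^+ m ord0 * 'X_i1 ^+ m ord_max.
exists (m ord0 + m ord_max + k)%N.
exists (c *: M * 'X_i2 ^+ k + P * 'X_i2 ^+ (m ord0 + m ord_max)).
have cX i : 'X_i \mPo affine_chart = tnth affine_chart i.
  by rewrite -['X_i \mPo _]/(mmap _ _ _) mmapX mmap1U.
have X2 : 'X_i2 \mPo affine_chart = 1 by rewrite cX.
have Xm : 'X_[m] = 'X_ord0 ^+ m ord0 * 'X_ord_max ^+ m ord_max :> {mpoly C[2]}.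
  rewrite mpolyXE_id !big_ord_recl big_ord0 mulr1.
  by have -> : lift ord0 (ord0 : 'I_1) = ord_max by apply: val_inj.
split; last first.
  rewrite -!mul_mpolyC !rmorphD /= !rmorphM /= !rmorphXn /= comp_mpolyC X2 !expr1n !mulr1 hP.
  by rewrite !cX Xm.
rewrite -!mul_mpolyC rmorphD /= !rmorphM /= affine_evalC Xm !rmorphM !rmorphXn /=.
rewrite affine_evalX0 affine_evalX1 mulrDl tofracD !tofracM -eP !tofracXn.
by rewrite (coordK i0) (coordK i1) !exprMn !exprD; ring.
Qed.

(** Dehomogenization is a left inverse, once denominators are cleared. *)
Lemma affine_eval_inj : injective affine_eval.
Proof.
move=> A B /eqP; rewrite -subr_eq0 -rmorphB => /eqP AB; apply/eqP; rewrite -subr_eq0.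
have [k [P [eP <-]]] := affine_eval_numerator (A - B).
have -> : P = 0 by apply: tofrac_inj; rewrite -eP AB mul0r tofrac0.
by rewrite raddf0.
Qed.

Lemma given_in_affineE (N1 D1 N2 D2 : {mpoly C[2]}) (f : ratmap R) :
    D1 != 0 -> D2 != 0 ->
  given_in_affine (tof2 N1 / tof2 D1, tof2 N2 / tof2 D2) f <->
  represents f (affine_eval N1 / affine_eval D1) (affine_eval N2 / affine_eval D2).
Proof.
move=> D10 D20.
have E0 A : (affine_eval A == 0) = (A == 0).
  by apply/eqP/eqP => [|->]; [rewrite -(rmorph0 affine_eval) => /affine_eval_inj | exact: rmorph0].
have dehE i : dehomogenize (tnth f i) = tof2 (tnth f i \mPo affine_chart) by [].
have hom i := affine_eval_homog (ratmap_homog f i).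
have z0 := tofX_neq0 C U_(i2); have zd := expf_neq0 (alg_degree f) z0.
have nz : (dehomogenize (tnth f i2) != 0) = (tnth f i2 != 0).
  by rewrite dehE tofrac_eq0 -E0 -(tofrac_eq0 (tnth f i2)) hom mulf_eq0 (negbTE zd).
have rel (N D : {mpoly C[2]}) i : D != 0 -> tnth f i2 != 0 ->
  tof2 N / tof2 D = dehomogenize (tnth f i) / dehomogenize (tnth f i2) <->
  tof (tnth f i) = affine_eval N / affine_eval D * tof (tnth f i2).
  move=> D0 f2; move: (f2); rewrite -nz => f2'.
  have De : affine_eval D != 0 by rewrite E0.
  have f2N : tnth f i2 \mPo affine_chart != 0 by rewrite -tofrac_eq0.
  rewrite (hom i) (hom i2).
  apply: (iff_trans _ (iff_sym (@cross_mul K _ _ _ _ _ zd De))).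
  rewrite (dehE i) (dehE i2).
  rewrite (tofrac_div_eq _ _ D0 f2N).
  split=> [/(congr1 affine_eval)|e]; first by rewrite !rmorphM.
  by apply: affine_eval_inj; rewrite !rmorphM.
split.
- case=> f1 [f2 [f3 [fE f30 /= e1 e2]]].
  have t0 : tnth f i0 = f1 by rewrite fE.
  have t1 : tnth f i1 = f2 by rewrite fE.
  have t2 : tnth f i2 = f3 by rewrite fE.
  have t20 : tnth f i2 != 0 by rewrite -nz t2.
  split; [exact: t20 | apply/(rel N1 D1 i0 D10 t20) | apply/(rel N2 D2 i1 D20 t20)].
    by rewrite t0 t2; exact: e1.
  by rewrite t1 t2; exact: e2.
- case=> f20 e1 e2; exists (tnth f i0), (tnth f i1), (tnth f i2).
  split; first by apply: eq_from_tnth; elim/ord3_cases.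
  + by rewrite nz.
  + exact/(rel N1 D1 i0 D10 f20).
  + exact/(rel N2 D2 i1 D20 f20).
Qed.

Lemma ratmap_of_affine_represents (N1 D1 N2 D2 : {mpoly C[2]}) u v a b :
    D1 != 0 -> D2 != 0 ->
    u = affine_eval N1 / affine_eval D1 -> v = affine_eval N2 / affine_eval D2 ->
    has_form u a -> has_form v b ->
  represents (ratmap_of_affine (tof2 N1 / tof2 D1, tof2 N2 / tof2 D2)) u v.
Proof.
move=> D10 D20 -> -> [P fP] [Q fQ]; rewrite /ratmap_of_affine; case: xgetP => [g _|].
  by move/given_in_affineE; apply.
move/(_ (reduced_ratmap fP fQ)); case; apply/given_in_affineE => //.
exact: reduced_triple_represents.
Qed.


End Affine.

(** * The iterates of the map *)

Lemma exchange_clear (L : fieldType) (x z d n g : L) : x != 0 -> z != 0 -> d != 0 ->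
  x * d * ((1 + n / d) / (x / z) * g) = z * (d + n) * g.
Proof. by move=> x0 z0 d0; field; rewrite z0 x0 d0. Qed.

Lemma exchange_solve (L : fieldType) (z f d n g1 g2 : L) : z != 0 -> f != 0 -> d != 0 ->
  z * f * d * g1 = f * (d + n * d) * g2 -> g1 = (1 + n) / z * g2.
Proof.
move=> z0 f0 d0 h; apply: (mulfI (mulf_neq0 (mulf_neq0 z0 f0) d0)); rewrite h.
by field.
Qed.

Lemma linear_transfer (A B : idomainType) (phi : {rmorphism A -> B})
    (x y g1 g2 : A) (z : {fraction B}) :
    y != 0 -> phi y != 0 -> tofrac (phi x) = z * tofrac (phi y) ->
    tofrac g1 = tofrac x / tofrac y * tofrac g2 ->
  tofrac (phi g1) = z * tofrac (phi g2).
Proof.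
move=> y0 py0 ex eg.
have y0' : tofrac y != 0 by rewrite tofrac_eq0.
have py0' : tofrac (phi y) != 0 by rewrite tofrac_eq0.
have rel : y * g1 = x * g2.
  by apply/eqP; rewrite -tofrac_eq !tofracM eg mulrA [_ * (_ / _)]mulrC divfK.
apply: (mulfI py0'); have := congr1 (fun a => tofrac (phi a)) rel.
by rewrite /= !(rmorphM phi) !tofracM ex => ->; rewrite mulrCA mulrA.
Qed.

(** Substitution [phi] does not extend to fractions, as it need not be injective.
    An exchange relation is therefore cleared of denominators, transported by [phi],
    and divided out again. *)
Lemma exchange_transfer (A B : idomainType) (phi : {rmorphism A -> B})
    (x y g1 g2 N D : A) e (z n : {fraction B}) :
    x != 0 -> y != 0 -> D != 0 -> phi D != 0 -> phi y != 0 -> z != 0 ->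
    tofrac (phi x) = z * tofrac (phi y) ->
    tofrac g1 = (1 + (tofrac N / tofrac D) ^+ e) / (tofrac x / tofrac y) * tofrac g2 ->
    tofrac (phi N) = n * tofrac (phi D) ->
  tofrac (phi g1) = (1 + n ^+ e) / z * tofrac (phi g2).
Proof.
move=> x0 y0 D0 pD0 py0 z0 ex eg eN.
have De : tofrac D ^+ e != 0 by rewrite expf_neq0 // tofrac_eq0.
have pDe : tofrac (phi D) ^+ e != 0 by rewrite expf_neq0 // tofrac_eq0.
have rel : x * D ^+ e * g1 = y * (D ^+ e + N ^+ e) * g2.
  apply/eqP; rewrite -tofrac_eq !tofracM eg tofracD !tofracXn expr_div_n; apply/eqP.
  by apply: exchange_clear; rewrite ?tofrac_eq0.
have /(congr1 (fun a => tofrac (phi a))) := rel.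
rewrite /= !(rmorphM phi) (rmorphD phi) !(rmorphXn phi) !tofracM tofracD !tofracXn.
by rewrite eN ex exprMn; apply: exchange_solve; rewrite ?tofrac_eq0.
Qed.

Section Iterates.
Context (R : realType) (p q : nat) (hp : (0 < p)%N) (hq : (0 < q)%N).
Local Notation C := (R[i]).
Local Notation poly := {mpoly C[3]}.
Local Notation K := {fraction {mpoly C[3]}}.
Local Notation tof := (@tofrac {mpoly C[3]}).
Local Notation cx := (coord C i0).
Local Notation cy := (coord C i1).
Local Notation w := (cluster C p q).

(** The image of [f] is not contained in the indeterminacy locus of [g]: the last
    coordinate of [g] is a monomial and [f] does not map into a coordinate line. *)
Lemma comp_denominator_neq0 (g f : ratmap R) u v u' v' a b :
    represents g u' v' -> has_form u' a -> has_form v' b ->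
    u != 0 -> v != 0 -> represents f u v ->
  tnth g i2 \mPo f != 0.
Proof.
move=> rg [P fP] [Q fQ] u0 v0 rf; have [_ [c c0 ->]] := represents_unique fP fQ rg.
rewrite comp_mpolyZ comp_mpolyX -mul_mpolyC mulf_neq0 ?mpolyC_eq0 //.
by apply/prodf_neq0 => i _; rewrite expf_neq0 // (represents_coord_neq0 _ u0 v0 rf).
Qed.

Lemma comp_represents (g f : ratmap R) u v a b :
    has_form u a -> has_form v b -> tnth g i2 \mPo f != 0 ->
    tof (tnth g i0 \mPo f) = u * tof (tnth g i2 \mPo f) ->
    tof (tnth g i1 \mPo f) = v * tof (tnth g i2 \mPo f) ->
  represents (ratmap_comp g f) u v.
Proof.
move=> fu fv gf0 e0 e1; apply: (reduce_represents fu fv).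
by split; rewrite !tnth_mktuple; [exact: gf0|exact: e0|exact: e1].
Qed.

Lemma comp_mpoly_tnth (f : 3.-tuple poly) i : 'X_i \mPo f = tnth f i.
Proof. by rewrite -['X_i \mPo _]/(mmap _ _ _) mmapX mmap1U. Qed.

Lemma mu1_represents : represents (mu1 R p q) (w 2) (w 1).
Proof.
have -> : mu1 R p q = ratmap_of_affine
    (tofrac (1 + 'X_ord_max ^+ q) / tofrac 'X_ord0, tofrac 'X_ord_max / tofrac 1).
  by rewrite tofracD tofrac1 tofracXn divr1.
apply: (ratmap_of_affine_represents (mpolyX_neq0 _ _) (oner_neq0 _) _ _
  (cluster_form C hp hq 2) (cluster_form C hp hq 1)).
  by rewrite rmorphD rmorph1 rmorphXn /= affine_evalX0 affine_evalX1.
by rewrite rmorph1 divr1 affine_evalX1.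
Qed.

Lemma mu2_form : exists b, has_form ((1 + cx ^+ p) / cy) b.
Proof.
have fx := coord_form C i0; have fy := coord_form C i1.
have ex : (1 + cx ^+ p) / cy * cy = 1 + cx ^+ p by rewrite divfK // (form_neq0 fy).
have Lv : laurent ((1 + cx ^+ p) / cy).
  apply: laurentM; last exact: coordV_laurent.
  by apply/laurentD/laurentX/form_laurent/fx; exact: laurent1.
by eexists; exact: form_exchange fy fx ex Lv.
Qed.

Lemma mu2_represents : represents (mu2 R p q) cx ((1 + cx ^+ p) / cy).
Proof.
have -> : mu2 R p q = ratmap_of_affine
    (tofrac 'X_ord0 / tofrac 1, tofrac (1 + 'X_ord0 ^+ p) / tofrac 'X_ord_max).
  by rewrite tofracD tofrac1 tofracXn divr1.
have [b fv] := mu2_form.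
apply: (ratmap_of_affine_represents (oner_neq0 _) (mpolyX_neq0 _ _) _ _ (coord_form C i0) fv).
  by rewrite rmorph1 divr1 affine_evalX0.
by rewrite rmorphD rmorph1 rmorphXn /= affine_evalX0 affine_evalX1.
Qed.

Lemma comp_exchange f (g1 g2 N D : poly) e j u v (z n : K) : 
    represents f u v -> D != 0 -> D \mPo f != 0 -> z != 0 ->
    tof (tnth f j) = z * tof (tnth f i2) ->
    tof g1 = (1 + (tof N / tof D) ^+ e) / coord C j * tof g2 ->
    tof (N \mPo f) = n * tof (D \mPo f) ->
  tof (g1 \mPo f) = (1 + n ^+ e) / z * tof (g2 \mPo f).
Proof.
move=> [f20 _ _] D0 Df0 z0 fj eg eN.
have X0 i : ('X_i : poly) != 0 := mpolyX_neq0 C U_(i).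
by apply: (@exchange_transfer poly poly (comp_mpoly f) 'X_j 'X_i2 g1 g2 N D e z n
  (X0 j) (X0 i2) D0 Df0 _ z0 _ eg eN); rewrite /= !comp_mpoly_tnth; [exact: f20|exact: fj].
Qed.

Lemma comp_linear f (g1 g2 : poly) j z : tnth f i2 != 0 ->
    tof (tnth f j) = z * tof (tnth f i2) -> tof g1 = coord C j * tof g2 ->
  tof (g1 \mPo f) = z * tof (g2 \mPo f).
Proof.
move=> f20 fj eg; have X0 : ('X_i2 : poly) != 0 := mpolyX_neq0 C U_(i2).
by apply: (@linear_transfer poly poly (comp_mpoly f) 'X_j 'X_i2 g1 g2 z X0 _ _ eg);
  rewrite /= !comp_mpoly_tnth; [exact: f20|exact: fj].
Qed.

Lemma mu_represents : represents (mu R p q) (w 2) (w 3).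
Proof.
have r2 := mu2_represents; have r1 := mu1_represents; have [r20 e20 e21] := r2.
have w1 := cluster_neq0 C hp hq 1; have w2 := cluster_neq0 C hp hq 2.
have [b fb] := mu2_form; have gf0 := comp_denominator_neq0 r2 (coord_form C i0) fb w2 w1 r1.
have [f20 x1 y1] := r1.
have rel0 := comp_linear f20 x1 e20.
apply: (comp_represents (cluster_form C hp hq 2) (cluster_form C hp hq 3) gf0 rel0).
have X0 : ('X_i2 : poly) != 0 := mpolyX_neq0 C U_(i2).
apply: (comp_exchange (N := 'X_i0) (D := 'X_i2) r1 X0 _ w1 y1 e21).
  by rewrite comp_mpoly_tnth; exact: f20.
by rewrite !comp_mpoly_tnth; exact: x1.
Qed.

(** One application of [mu] performs two exchanges; the second coordinate of [mu] is
    an exchange relation in which the new first coordinate plays the part of the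
    variable. *)
Lemma iter_represents n :
  represents (ratmap_iter n (mu R p q)) (w n.*2) (w n.*2.+1).
Proof.
have X0 i : ('X_i : poly) != 0 := mpolyX_neq0 C U_(i).
elim: n => [|n IH].
  have idE i : tnth (ratmap_id R) i = 'X_i by rewrite tnth_mktuple.
  by split; rewrite !idE; [exact: X0 | exact: coordK | exact: coordK].
have rmu := mu_represents; have [g20 eg0 eg1] := rmu.
have wN0 k := cluster_neq0 C hp hq k; have wf k := cluster_form C hp hq k.
rewrite /ratmap_iter iterS -/(ratmap_iter n _) doubleS.
set f := ratmap_iter n _ in IH *.
have gf0 := comp_denominator_neq0 rmu (wf 2) (wf 3) (wN0 _) (wN0 _) IH.
have [f20 f0 f1] := IH.
have w2E : w n.*2.+2 = (1 + w n.*2.+1 ^+ q) / w n.*2.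
  by rewrite [LHS]rec2S /exch_exp /= odd_double.
have w3E : w n.*2.+3 = (1 + w n.*2.+2 ^+ p) / w n.*2.+1.
  by rewrite [LHS]rec2S /exch_exp /= odd_double.
have rel0 : tof (tnth (mu R p q) i0 \mPo f) = w n.*2.+2 * tof (tnth (mu R p q) i2 \mPo f).
  rewrite w2E; apply: (comp_exchange (N := 'X_i1) (D := 'X_i2) IH (X0 i2) _ (wN0 _) f0 eg0).
    by rewrite comp_mpoly_tnth; exact: f20.
  by rewrite !comp_mpoly_tnth; exact: f1.
apply: (comp_represents (wf _) (wf _) gf0 rel0).
rewrite w3E; apply: (comp_exchange IH g20 gf0 (wN0 _) f1 _ rel0).
rewrite eg1 eg0 mulfK; last by rewrite tofrac_eq0; exact: g20.
by [].
Qed.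

Theorem alg_degree_iter n : alg_degree (ratmap_iter n (mu R p q)) =
  mdeg (common_denom (trop p q ^~ n.*2) (trop p q ^~ n.*2.+1)).
Proof.
have [P fP] := cluster_form C hp hq n.*2; have [Q fQ] := cluster_form C hp hq n.*2.+1.
by have [->] := represents_unique fP fQ (iter_represents n).
Qed.

End Iterates.

(** * Growth of tropical orbits *)

Section Tropical.
Context (R : realType) (p q : nat).

Definition trop_step (s : int * int) : int * int :=
  let u := Num.max 0 (q%:Z * s.2) - s.1 in (u, Num.max 0 (p%:Z * u) - s.2).

(** The growth allowed for a sequence: the linear factor is there for [p * q = 4],
    where [l = 1] is a double root, and it is harmless for the dynamical degree. *)
Definition linexp_bounded (l : R) (s : nat -> int) :=
  exists2 A : R, 0 <= A & forall n, `|s n|%:~R <= A * n.+1%:R * l ^+ n.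

Lemma linexp_bounded_shift l s : 1 <= l -> linexp_bounded l (fun n => s n.+1) -> linexp_bounded l s.
Proof.
move=> l1 [A A0 h]; exists (A + `|s 0%N|%:~R); first by rewrite addr_ge0 // ler0z.
have s0 : 0 <= `|s 0%N|%:~R :> R by rewrite ler0z.
case=> [|n]; first by rewrite !mulr1 lerDr.
apply: le_trans (h n) _; apply: ler_pM.
- by rewrite mulr_ge0.
- by rewrite exprn_ge0 // (le_trans ler01).
- by apply: ler_pM => //; rewrite ?lerDl // ler_nat.
- by apply: ler_weXn2l.
Qed.

Section Orbit.
Context (l : R) (l1 : 1 <= l) (hl : l ^+ 2 - ((p * q)%:R - 2) * l + 1 = 0).
Context (hp : (0 < p)%N) (hq : (0 < q)%N) (hpq : (4 <= p * q)%N).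
Context (U V : nat -> int).
Hypothesis HU : forall n, U n.+1 = Num.max 0 (q%:Z * V n) - U n.
Hypothesis HV : forall n, V n.+1 = Num.max 0 (p%:Z * U n.+1) - V n.
Hypothesis V0 : 0 <= V 0%N.
Hypothesis UV0 : p%:Z * U 0%N <= 2 * V 0%N.

(** On the cone [0 <= V, p U <= 2 V] both maxima are attained by their second
    argument, and [4 <= p q] makes the cone invariant. *)
Lemma trop_cone n : [/\ 0 <= V n, p%:Z * U n <= 2 * V n & 0 <= U n.+1].
Proof.
have pqZ : 4 <= p%:Z * q%:Z by rewrite -PoszM lez_nat.
have next v u : 0 <= v -> p%:Z * u <= 2 * v -> 2 * u <= q%:Z * v.
  move=> v0 uv; have qv0 : 0 <= q%:Z * v by rewrite mulr_ge0.
  have [u0|u0] := lerP u 0; first lia.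
  have : q%:Z * (p%:Z * u) <= q%:Z * (2 * v) by rewrite ler_wpM2l.
  have : 4 * u <= p%:Z * q%:Z * u by rewrite ler_wpM2r // ltW.
  nia.
have Uge0 v u : 0 <= v -> 2 * u <= q%:Z * v -> 0 <= q%:Z * v - u.
  by move=> v0; have : 0 <= q%:Z * v by [rewrite mulr_ge0]; lia.
have UE k : 0 <= V k -> U k.+1 = q%:Z * V k - U k.
  by move=> v0; rewrite HU max_r // mulr_ge0.
elim: n => [|n [v0 uv u0]].
  by split=> //; rewrite UE //; apply: Uge0 => //; exact: next.
have uv' := next _ _ v0 uv; have uE := UE n v0.
have vE : V n.+1 = p%:Z * U n.+1 - V n by rewrite HV max_r // mulr_ge0.
have pu0 : 0 <= p%:Z * U n.+1 by rewrite mulr_ge0.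
have vv : p%:Z * U n.+1 <= 2 * V n.+1.
  have : 4 * V n <= p%:Z * q%:Z * V n by rewrite ler_wpM2r.
  have : p%:Z * (q%:Z * V n) <= p%:Z * (2 * U n.+1).
    by rewrite ler_wpM2l // uE; lia.
  by rewrite vE; nia.
have v0' : 0 <= V n.+1 by lia.
by split=> //; rewrite UE //; apply: Uge0 => //; exact: next.
Qed.

Lemma trop_linear n : U n.+2 = ((p * q)%:Z - 2) * U n.+1 - U n.
Proof.
have [v0 _ u0] := trop_cone n; have [v1 _ _] := trop_cone n.+1.
have e1 : U n.+1 = q%:Z * V n - U n by rewrite HU max_r // mulr_ge0.
have e2 : V n.+1 = p%:Z * U n.+1 - V n by rewrite HV max_r // mulr_ge0.
have -> : U n.+2 = q%:Z * V n.+1 - U n.+1 by rewrite HU max_r // mulr_ge0.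
have qV : q%:Z * V n = U n.+1 + U n by rewrite e1 subrK.
by rewrite e2 PoszM mulrBr qV; ring.
Qed.

(** If [l] and [1 / l] are the roots of [z ^ 2 - (p q - 2) z + 1], the sequence
    [l U (n + 1) - U n] is geometric of ratio [l]. *)
Lemma trop_first_order n :
  l * (U n.+1)%:~R = (U n)%:~R + (l * (U 1%N)%:~R - (U 0%N)%:~R) * l ^+ n.
Proof.
elim: n => [|n IH]; first by rewrite mulr1 addrC subrK.
have lE : l * ((p * q)%:R - 2) = l ^+ 2 + 1.
  by move: hl => /eqP; rewrite addrAC subr_eq0 => /eqP ->; rewrite mulrC.
set E := (_ - _) in IH *.
have e : E * l ^+ n = l * (U n.+1)%:~R - (U n)%:~R by rewrite IH addrAC subrr add0r.
have -> : (U n.+2)%:~R = ((p * q)%:R - 2) * (U n.+1)%:~R - (U n)%:~R :> R.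
  by rewrite trop_linear rmorphB rmorphM rmorphB.
rewrite mulrBr mulrA lE (exprS l n) [E * _]mulrCA e; ring.
Qed.

Lemma trop_orbit_growth : linexp_bounded l U /\ linexp_bounded l V.
Proof.
have l0 : 0 <= l := le_trans ler01 l1.
have ln0 n : 0 <= l ^+ n by rewrite exprn_ge0.
have Up n : 0 <= (U n.+1)%:~R :> R by rewrite ler0z; case: (trop_cone n).
set E := l * (U 1%N)%:~R - (U 0%N)%:~R.
have bU : linexp_bounded l (fun n => U n.+1).
  pose A := (U 1%N)%:~R + `|E| * l.
  have El0 : 0 <= `|E| * l by rewrite mulr_ge0.
  have A0 : 0 <= A by rewrite addr_ge0.
  exists A => // n; rewrite ger0_norm; last by case: (trop_cone n).
  elim: n => [|n IH]; first by rewrite !mulr1 lerDl.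
  have h1 : (U n.+2)%:~R <= (U n.+1)%:~R + `|E| * l * l ^+ n.
    apply: (@le_trans _ _ (l * (U n.+2)%:~R)); first by rewrite ler_peMl.
    by rewrite trop_first_order lerD2l -mulrA -exprS ler_wpM2r // ler_norm.
  apply: (le_trans h1); apply: (@le_trans _ _ (A * n.+2%:R * l ^+ n)).
    have -> : A * n.+2%:R * l ^+ n = A * n.+1%:R * l ^+ n + A * l ^+ n.
      by rewrite -(natr1 n.+1); ring.
    by rewrite lerD // ler_wpM2r // lerDr.
  by rewrite ler_wpM2l ?mulr_ge0 // ler_weXn2l.
have bU' := linexp_bounded_shift l1 bU; split=> //.
case: bU' => B B0 hB; exists (3 * B * l) => [|n]; first by rewrite !mulr_ge0.
have [v0 _ _] := trop_cone n.
have vU : `|V n| <= `|U n.+1| + `|U n|.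
  have e1 : U n.+1 = q%:Z * V n - U n by rewrite HU max_r // mulr_ge0.
  have : V n <= q%:Z * V n by rewrite ler_peMl //; lia.
  lia.
have vU' : `|V n|%:~R <= `|U n.+1|%:~R + `|U n|%:~R :> R by rewrite -intrD ler_int.
apply: (le_trans vU'); apply: (le_trans (lerD (hB n.+1) (hB n))).
have -> : 3 * B * l * n.+1%:R * l ^+ n =
    B * (2 * n.+1%:R) * l ^+ n.+1 + B * n.+1%:R * (l * l ^+ n).
  by rewrite exprS; ring.
apply: lerD; apply: ler_pM; rewrite ?mulr_ge0 //.
  by rewrite ler_wpM2l // -natrM ler_nat; lia.
by rewrite ler_peMl.
Qed.

Lemma trop_orbit_lower n : U 0%N = -1 -> V 0%N = 0 -> l ^+ n <= (U n.+1)%:~R.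
Proof.
move=> U0 V00; have l0 : 0 < l := lt_le_trans ltr01 l1.
have U1 : U 1%N = 1 by rewrite HU V00 U0 mulr0 maxxx.
have Un : 0 <= (U n)%:~R + l ^+ n.
  case: n => [|n]; first by rewrite U0 addrC subrr.
  by rewrite addr_ge0 ?exprn_ge0 ?(ltW l0) // ler0z; case: (trop_cone n).
rewrite -(ler_pM2l l0) trop_first_order U0 U1 mulr1 opprK mulrDl mul1r.
by rewrite addrCA lerDl.
Qed.

End Orbit.

(** A periodic orbit takes finitely many values. *)
Lemma linexp_bounded_periodic (s0 : int * int) (U V : nat -> int) N :
    (forall n, (U n, V n) = iter n trop_step s0) ->
    (0 < N)%N -> iter N trop_step s0 = s0 ->
  linexp_bounded 1 U /\ linexp_bounded 1 V.
Proof.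
move=> UV N0 per.
have mod n : iter n trop_step s0 = iter (n %% N) trop_step s0.
  rewrite {1}(divn_eq n N) addnC iterD; congr (iter _ _ _).
  by elim: (n %/ N)%N => [|k IH] //; rewrite mulSn iterD IH.
pose bnd n := (`|(iter n trop_step s0).1| + `|(iter n trop_step s0).2|)%R.
pose A := \sum_(i < N) bnd i.
have bA n : bnd n <= A.
  rewrite /bnd mod -/(bnd _) /A (bigD1 (Ordinal (ltn_pmod n N0))) //= lerDl.
  by apply: sumr_ge0 => i _; rewrite addr_ge0.
have A0 : 0 <= A by apply: sumr_ge0 => i _; rewrite addr_ge0.
have bU n : `|U n| <= A by apply: le_trans (bA n); rewrite /bnd -UV /= lerDl.
have bV n : `|V n| <= A by apply: le_trans (bA n); rewrite /bnd -UV /= lerDr.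
have key (s : nat -> int) : (forall n, `|s n| <= A) -> linexp_bounded 1 s.
  move=> h; exists A%:~R => [|n]; first by rewrite ler0z.
  rewrite expr1n mulr1; apply: (@le_trans _ _ A%:~R); first by rewrite ler_int.
  by rewrite ler_peMr ?ler0z // ler1n.
by split; apply: key.
Qed.

Definition trop_start (s : int * int) := s \in ([:: (-1, 0); (0, -1); (1, 1)] : seq (int * int)).

(** Finite type: the orbits have periods 5, 3 or 4, all of which divide 60. *)
Lemma trop_growth_small s0 (U V : nat -> int) :
    (0 < p)%N -> (0 < q)%N -> (p * q <= 3)%N -> trop_start s0 ->
    (forall n, (U n, V n) = iter n trop_step s0) ->
  linexp_bounded 1 U /\ linexp_bounded 1 V.
Proof.
move=> hp hq pq3 st UV; apply: (linexp_bounded_periodic (N := 60) UV) => //.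
have : all (fun s => iter 60 trop_step s == s) [:: (-1, 0); (0, -1); (1, 1)].
  rewrite /trop_step; case: p q hp hq pq3 => [|[|[|[|p']]]] [|[|[|[|q']]]] hp hq pq3;
    first [by exfalso; move: hp hq pq3; clear; nia | by vm_compute].
by move=> /allP /(_ _ st) /eqP.
Qed.

(** The three orbits enter the cone after at most two steps. *)
Lemma trop_growth_large l s0 (U V : nat -> int) :
    1 <= l -> l ^+ 2 - ((p * q)%:R - 2) * l + 1 = 0 ->
    (0 < p)%N -> (0 < q)%N -> (4 <= p * q)%N -> trop_start s0 ->
    (forall n, (U n, V n) = iter n trop_step s0) ->
  linexp_bounded l U /\ linexp_bounded l V.
Proof.
move=> l1 hl hp hq pq4 st UV.
have UVS n : (U n.+1, V n.+1) = trop_step (U n, V n) by rewrite !UV.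
have HU n : U n.+1 = Num.max 0 (q%:Z * V n) - U n by case: (UVS n).
have HV n : V n.+1 = Num.max 0 (p%:Z * U n.+1) - V n.
  by case: (UVS n) => <-.
have shifted k : 0 <= V k -> p%:Z * U k <= 2 * V k -> linexp_bounded l U /\ linexp_bounded l V.
  move=> v0 uv; pose U' n := U (k + n)%N; pose V' n := V (k + n)%N.
  have HU' n : U' n.+1 = Num.max 0 (q%:Z * V' n) - U' n by rewrite /U' addnS HU.
  have HV' n : V' n.+1 = Num.max 0 (p%:Z * U' n.+1) - V' n by rewrite /V' /U' !addnS HV.
  have := trop_orbit_growth l1 hl hp hq pq4 HU' HV'.
  rewrite /U' /V' !addn0 => /(_ v0 uv).
  elim: {UVS v0 uv U' V' HU' HV'}k => // k IH [h1 h2]; apply: IH; split.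
    by apply: linexp_bounded_shift => //; case: h1 => A A0 h; exists A => // n; rewrite addnS -addSn.
  by apply: linexp_bounded_shift => //; case: h2 => A A0 h; exists A => // n; rewrite addnS -addSn.
have [U0 V0] : (U 0%N = s0.1) * (V 0%N = s0.2).
  by have := UV 0%N; case: (s0) => a b [-> ->].
move: st; rewrite /trop_start !inE => /or3P[] /eqP s0E; move: U0 V0; rewrite s0E /= => U0 V0.
- by apply: (shifted 0%N); rewrite ?U0 ?V0; lia.
- apply: (shifted 1%N).
    by rewrite HV HU U0 V0; nia.
  by rewrite HV HU U0 V0; nia.
- have [q1|q2] : (q = 1 \/ 2 <= q)%N by lia.
    have p4 : (4 <= p)%N by move: pq4; rewrite q1 muln1.
    have e1 : U 1%N = 0 by rewrite HU U0 V0; lia.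
    have e2 : V 1%N = -1 by rewrite HV e1 V0; lia.
    have e3 : U 2%N = 0 by rewrite HU e1 e2; lia.
    have e4 : V 2%N = 1 by rewrite HV e3 e2; lia.
    by apply: (shifted 2%N); rewrite ?e3 ?e4; lia.
  have e1 : U 1%N = q%:Z - 1 by rewrite HU U0 V0; lia.
  have e2 : V 1%N = p%:Z * (q%:Z - 1) - 1 by rewrite HV e1 V0 max_r //; nia.
  by apply: (shifted 1%N); rewrite e2 ?e1; nia.
Qed.

End Tropical.

(** * Roots of sequences of exponential growth *)

Section RootGrowth.
Context (R : realType).
Local Open Scope classical_set_scope.
Local Open Scope ring_scope.

(** From [ln x = 2 ln (sqrt x) <= 2 sqrt x]. *)
Lemma ln_div_le (n : nat) : ln n.+2%:R / n.+1%:R <= 4 * Num.sqrt (@harmonic R n).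
Proof.
have n0 : 0 < n.+1%:R :> R by [].
set s := Num.sqrt n.+1%:R : R.
have s0 : 0 < s by rewrite sqrtr_gt0.
have sE : s ^+ 2 = n.+1%:R by rewrite sqr_sqrtr.
have t0 : 0 < Num.sqrt n.+2%:R :> R by rewrite sqrtr_gt0.
have h1 : ln n.+2%:R <= 2 * Num.sqrt n.+2%:R :> R.
  rewrite -{1}(@sqr_sqrtr R n.+2%:R) // lnXn // -[ln _ *+ _]mulr_natl ler_wpM2l //.
  by apply/ltW/ln_sublinear.
have h2 : Num.sqrt n.+2%:R <= 2 * s.
  rewrite -(@ler_pXn2r _ 2) ?nnegrE ?mulr_ge0 ?(ltW s0) ?(ltW t0) // exprMn sE sqr_sqrtr //.
  have -> : 2 ^+ 2 * n.+1%:R = (4 * n.+1)%:R :> R by rewrite natrM -(natrX _ 2 2).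
  by rewrite ler_nat; lia.
have -> : Num.sqrt (harmonic n) = s^-1 by rewrite /harmonic sqrtrV.
rewrite ler_pdivrMr // -sE.
have -> : 4 * s^-1 * s ^+ 2 = 2 * (2 * s) by field; rewrite gt_eqF.
by apply: (le_trans h1); rewrite ler_wpM2l.
Qed.

Lemma root_growth (l A : R) (d : nat -> nat) : 1 <= l ->
    (forall n, l ^+ n <= (d n.+1)%:R) ->
    (forall n, (d n)%:R <= A * n.+1%:R * l ^+ n) ->
  (fun n => (d n)%:R `^ n%:R^-1) @ \oo --> l.
Proof.
move=> l1 lo up; have l0 : 0 < l := lt_le_trans ltr01 l1.
have ln0 n : 0 < l ^+ n by rewrite exprn_gt0.
have d0 n : 0 < (d n.+1)%:R :> R by apply: lt_le_trans (ln0 n) (lo n).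
have A0 : 0 < A.
  have := lt_le_trans (d0 0%N) (up 1%N).
  by rewrite -mulrA pmulr_lgt0 // mulr_gt0.
rewrite -(cvg_shiftS (fun n => (d n)%:R `^ n%:R^-1)) /=.
have -> : (fun n => (d n.+1)%:R `^ n.+1%:R^-1) =
    (fun n => expR (ln (d n.+1)%:R / n.+1%:R)) :> (nat -> R).
  by apply/funext => n; rewrite /powR gt_eqF // mulrC.
have lE : expR (ln l) = l by rewrite lnK ?posrE.
suff lim : (fun n => ln (d n.+1)%:R / n.+1%:R : R) @ \oo --> ln l.
  rewrite -lE; exact: (@continuous_cvg _ _ _ _ _ _ (@expR R) _ (@continuous_expR R (ln l)) lim).
have H0 : @harmonic R @ \oo --> (0 : R) := cvg_harmonic.
have S0 : (fun n => Num.sqrt (@harmonic R n)) @ \oo --> (0 : R).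
  have -> : 0 = Num.sqrt 0 :> R by rewrite sqrtr0.
  exact: (@continuous_cvg _ _ _ _ _ _ (@Num.sqrt R) _ (@sqrt_continuous R 0) H0).
have Z c (u : nat -> R) : u @ \oo --> (0 : R) -> (fun n => c * u n) @ \oo --> (0 : R).
  by move=> hu; rewrite -(mulr0 c); apply: cvgM => //; exact: cvg_cst.
apply: (@squeeze_cvgr _ _ _ _
  (fun n => ln l - ln l * harmonic n)
  (fun n => ln l + (ln A * harmonic n + 4 * Num.sqrt (harmonic n)))).
- apply: nearW => n; have n0 : 0 < n.+1%:R :> R by [].
  have e : ln l - ln l * harmonic n = n%:R * ln l / n.+1%:R.
    have -> : n%:R = n.+1%:R - 1 :> R by rewrite -natr1 addrK.
    by rewrite /harmonic /=; move: n.+1%:R n0 => m m0; field; rewrite gt_eqF.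
  apply/andP; split.
    rewrite e ler_wpM2r ?invr_ge0 // mulr_natl -lnXn // ler_ln ?posrE //.
  apply: (@le_trans _ _ ((ln A + ln n.+2%:R + n.+1%:R * ln l) / n.+1%:R)).
    rewrite ler_wpM2r ?invr_ge0 // mulr_natl -lnXn // -!lnM ?posrE ?mulr_gt0 //.
    by rewrite ler_ln ?posrE ?mulr_gt0.
  have -> : (ln A + ln n.+2%:R + n.+1%:R * ln l) / n.+1%:R =
      ln l + (ln A * harmonic n + ln n.+2%:R / n.+1%:R).
    by rewrite /harmonic /=; move: n.+1%:R n0 => m m0; field; rewrite gt_eqF.
  by rewrite !lerD2l ln_div_le.
- have := cvgB (cvg_cst (ln l)) (Z (ln l) _ H0); rewrite subr0; exact.
- have := cvgD (cvg_cst (ln l)) (cvgD (Z (ln A) _ H0) (Z 4 _ S0)).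
  rewrite !addr0; exact.
Qed.

End RootGrowth.

(** * The dynamical degree *)

Section DegreeGrowth.
Context (R : realType) (p q : nat) (hp : (0 < p)%N) (hq : (0 < q)%N).
Local Notation deg n := (alg_degree (ratmap_iter n (mu R p q))).

Lemma trop_iter i n : (trop p q i n.*2, trop p q i n.*2.+1) =
  iter n (trop_step p q) (coord_vec i0 i, coord_vec i1 i).
Proof.
elim: n => [//|n IH]; rewrite iterS -IH doubleS /trop_step /=.
have e2 : trop p q i n.*2.+2 = Num.max 0 (q%:Z * trop p q i n.*2.+1) - trop p q i n.*2.
  by rewrite [LHS]rec2S /exch_exp /= odd_double.
have e3 : trop p q i n.*2.+3 = Num.max 0 (p%:Z * trop p q i n.*2.+2) - trop p q i n.*2.+1.
  by rewrite [LHS]rec2S /exch_exp /= odd_double.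
by rewrite e3 e2.
Qed.

Lemma trop_start_coord i : trop_start (coord_vec i0 i, coord_vec i1 i).
Proof. by elim/ord3_cases: i. Qed.

(** The tropical exchange is invertible, so an orbit that reaches 0 started at 0. *)
Lemma trop_neq0 k : ~ forall i, trop p q i k = 0 /\ trop p q i k.+1 = 0.
Proof.
elim: k => [|k IH] h; first by have [] := h i0.
apply: IH => i; have [h1] := h i; rewrite [trop _ _ _ k.+2]rec2S => h2; split=> //.
by move: h2; rewrite -/(trop p q i) h1 mulr0 maxxx sub0r => /eqP; rewrite oppr_eq0 => /eqP.
Qed.

Lemma trop_sum_ge0 k : 0 <= \sum_i trop p q i k.
Proof. by have [P [[d _ <-] _ _]] := cluster_form R[i] hp hq k. Qed.

(** A pair of pole-free cluster variables would have all exponents 0, because the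
    exponents of each variable have a nonnegative sum, the degree of its numerator. *)
Lemma degree_gt0 n : (0 < deg n)%N.
Proof.
rewrite alg_degree_iter // lt0n; apply/negP; rewrite mdeg_eq0 => /eqP /mnmP t0.
have le0 i : trop p q i n.*2 <= 0 /\ trop p q i n.*2.+1 <= 0.
  by have := t0 i; rewrite !mnmE; lia.
have all0 k : (forall i, trop p q i k <= 0) -> forall i, trop p q i k = 0.
  move=> h i; apply/eqP; rewrite eq_le h /=.
  apply: le_trans (trop_sum_ge0 k) _; rewrite (bigD1 i) //= gerDl.
  by apply: sumr_le0.
by apply: (@trop_neq0 n.*2) => i; split; apply: all0 => j; case: (le0 j).
Qed.

Lemma degree_le n : (deg n)%:Z <= \sum_i (`|trop p q i n.*2| + `|trop p q i n.*2.+1|).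
Proof.
rewrite alg_degree_iter // mdegE (big_morph Posz PoszD (erefl _)).
by apply: ler_sum => i _; rewrite mnmE; lia.
Qed.

Lemma degree_ge i n : trop p q i n.*2 <= (deg n)%:Z.
Proof.
rewrite alg_degree_iter // mdegE (bigD1 i) //= PoszD.
by have := common_denom_gea (trop p q ^~ n.*2) (trop p q ^~ n.*2.+1) i; lia.
Qed.

Lemma degree_growth_cvg (l : R) : 1 <= l ->
    (forall n, l ^+ n <= (deg n.+1)%:R) ->
    (forall i, linexp_bounded l (fun n => trop p q i n.*2) /\
               linexp_bounded l (fun n => trop p q i n.*2.+1)) ->
  (degree_growth (mu R p q) @ \oo --> l)%classic.
Proof.
move=> l1 lo sub.
have /choice[A hA] i : exists a : R, forall n,
    (`|trop p q i n.*2| + `|trop p q i n.*2.+1|)%:~R <= a * n.+1%:R * l ^+ n.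
  have [[A1 _ h1] [A2 _ h2]] := sub i; exists (A1 + A2) => n.
  by rewrite intrD !mulrDl lerD.
apply: (@root_growth _ l (\sum_i A i)) => // n.
have : ((deg n)%:Z)%:~R <= (\sum_i (`|trop p q i n.*2| + `|trop p q i n.*2.+1|))%:~R :> R.
  by rewrite ler_int degree_le.
move=> h; apply: (le_trans h); rewrite rmorph_sum !mulr_suml /=.
by apply: ler_sum => i _; exact: hA.
Qed.

Lemma degree_growth_small : (p * q <= 4)%N -> (degree_growth (mu R p q) @ \oo --> (1 : R))%classic.
Proof.
move=> pq4; apply: degree_growth_cvg => // [n|i].
  by rewrite expr1n ler1n degree_gt0.
have := trop_start_coord i; have := trop_iter i.
have [pq3|pq_eq] : (p * q <= 3)%N \/ (p * q = 4)%N by lia.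
  by move=> h st; exact: (trop_growth_small R hp hq pq3 st h).
move=> h st; apply: (trop_growth_large (l := 1) _ _ hp hq _ st h) => //.
  by rewrite pq_eq; ring.
by rewrite pq_eq.
Qed.

Definition growth_rate : R :=
  ((p * q)%:R - 2 + Num.sqrt (((p * q)%:R - 2) ^+ 2 - 4)) / 2.

Lemma growth_rate_gt1 : (4 < p * q)%N -> 1 < growth_rate.
Proof.
move=> pq; have m3 : 5%:R <= (p * q)%:R :> R by rewrite ler_nat.
have : 0 <= Num.sqrt (((p * q)%:R - 2) ^+ 2 - 4) :> R by rewrite sqrtr_ge0.
rewrite /growth_rate; lra.
Qed.

Lemma growth_rate_root : (4 < p * q)%N ->
  growth_rate ^+ 2 - ((p * q)%:R - 2) * growth_rate + 1 = 0.
Proof.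
move=> pq; have m3 : 5%:R <= (p * q)%:R :> R by rewrite ler_nat.
rewrite /growth_rate; set m := _ - 2; have m3' : 3 <= m by rewrite /m; lra.
have : Num.sqrt (m ^+ 2 - 4) ^+ 2 = m ^+ 2 - 4 by rewrite sqr_sqrtr //; nra.
by move: (Num.sqrt _) => s e; field: e.
Qed.

Lemma degree_growth_large : (4 < p * q)%N -> (degree_growth (mu R p q) @ \oo --> growth_rate)%classic.
Proof.
move=> pq; have l1 := ltW (growth_rate_gt1 pq); have lr := growth_rate_root pq.
apply: degree_growth_cvg => // [n|i]; last first.
  exact: (trop_growth_large l1 lr hp hq (ltnW pq) (trop_start_coord i) (trop_iter i)).
pose U n := trop p q i0 n.*2; pose V n := trop p q i0 n.*2.+1.
have UVS k : (U k.+1, V k.+1) = trop_step p q (U k, V k) by rewrite /U /V !trop_iter.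
have HU k : U k.+1 = Num.max 0 (q%:Z * V k) - U k by case: (UVS k).
have HV k : V k.+1 = Num.max 0 (p%:Z * U k.+1) - V k by case: (UVS k) => <-.
have U0 : U 0%N = -1 by []. have V0 : V 0%N = 0 by [].
have V0' : 0 <= V 0%N by rewrite V0.
have UV0 : p%:Z * U 0%N <= 2 * V 0%N by rewrite U0 V0; lia.
have := trop_orbit_lower l1 lr hp hq (ltnW pq) HU HV V0' UV0 n U0 V0.
move=> h; apply: (le_trans h); rewrite -[X in _ <= X]/((deg n.+1)%:Z%:~R).
by rewrite ler_int degree_ge.
Qed.

End DegreeGrowth.

Unset Implicit Arguments.

Theorem theoremA (R : realType) (p q : nat) (hp : (1 <= p)%N) (hq : (1 <= q)%N) :
  cvgn (degree_growth (mu R p q)) /\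
  ((p * q <= 4)%N -> dynamical_degree (mu R p q) = 1) /\
  ((4 < p * q)%N ->
    dynamical_degree (mu R p q) =
      ((p * q)%:R - 2 + Num.sqrt (((p * q)%:R - 2) ^+ 2 - 4)) / 2 /\
    1 < dynamical_degree (mu R p q)).
Proof.
have small := @degree_growth_small R p q hp hq; have large := @degree_growth_large R p q hp hq.
split; last split.
- by have [/small|/large] := leqP (p * q) 4 => h; apply/cvg_ex; eexists; exact: h.
- by move=> /small; apply: cvg_lim.
- move=> pq; have -> : dynamical_degree (mu R p q) = growth_rate R p q.
    by apply: cvg_lim => //; exact: large.
  by split=> //; exact: growth_rate_gt1.
Qed.
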